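(* If a semigroup $S$ has maximal global cogrowth with respect to some finite choice of generators $X$, then the associated right (or left) random walk Markov operator on $\ell_2(S^1)$ is either not defined or has spectral radius at least $1$.
   Context: $S^1$ denotes $S$ with an identity element adjoined if $S$ has no identity, and $S^1=S$ otherwise. A finite choice of generators for a semigroup $S$ is a finite set $X$ of symbols together with a surjective morphism $X^+\to S$, $w\mapsto\overline{w}$, from the free semigroup on $X$; $|w|$ is the length of a word $w$. The global cogrowth function $\gamma^{S,X}(n)$ ($n\geq1$) is the number of pairs $(u,v)$ of non-empty words over $X$ with $|u|+|v|=n$ and $\overline{u}=\overline{v}$ in $S$. The global cogrowth rate is $\gamma^{S,X}=\limsup_{n\to\infty}(\gamma^{S,X}(n))^{1/n}\leq|X|$; $S$ has maximal global cogrowth with respect to $X$ if $\gamma^{S,X}=|X|$. The right random walk Markov operator associated with $X$ is given by the $S^1\times S^1$ matrix $M_{s,t}=|\{x\in X: s\overline{x}=t\}|/|X|$, acting by $(vM)(t)=\sum_{s\in S^1}v(s)M_{s,t}$. The left random walk Markov operator is given in the same way by the matrix with $(s,t)$ entry $|\{x\in X:\overline{x}s=t\}|/|X|$. The operator is ''defined on $\ell_2(S^1)$'' if for every $v\in\ell_2(S^1)$ all these sums converge and the result lies in $\ell_2(S^1)$; in this case it is automatically bounded. The spectral radius of $M$ is the supremum of $|\lambda|$ over all complex $\lambda$ such that $M-\lambda I$ is singular (not invertible); equivalently it equals $\limsup_{n\to\infty}\|M^n\|_2^{1/n}$, where $\|\cdot\|_2$ is the operator norm on $\ell_2(S^1)$.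 *)

(* Defs.v *)
From HB Require Import structures.
From mathcomp Require Import all_boot all_order all_algebra finmap.
From mathcomp Require Import all_classical all_reals all_analysis.
From mathcomp Require Import showcase.summability.
From mathcomp Require Import complex.

Set Implicit Arguments.
Unset Strict Implicit.
Unset Printing Implicit Defensive.

Import Order.TTheory GRing.Theory Num.Theory.
Import numFieldNormedType.Exports.

Local Open Scope classical_set_scope.
Local Open Scope ring_scope.
Local Open Scope complex_scope.

Record word (X : finType) := Word {
  letters :> seq X;
  letters_neq0 : letters != [::]
}.

HB.instance Definition _ (X : finType) := [isSub for @letters X].
HB.instance Definition _ (X : finType) := [Choice of word X by <:].

Section FreeSemigroup.
Variable X : finType.
Implicit Types u v : word X.

Fact cat_word_neq0 u v : (letters u ++ letters v) != [::].
Proof. by case: u v => [[|x u] //= _] v. Qed.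

Definition cat_word u v : word X := Word (cat_word_neq0 u v).

Fact cat_wordA : associative cat_word.
Proof. by move=> u v w; apply/val_inj/catA. Qed.

HB.instance Definition _ := isSemigroup.Build (word X) cat_wordA.

Definition letter (x : X) : word X := @Word X [:: x] isT.

End FreeSemigroup.

Definition has_identity (S : semigroupType) : Prop :=
  exists e : S, left_id e *%g /\ right_id e *%g.

(* [None] is the adjoined identity; it is an element of [adjoin1 S] only when
   [S] has no identity of its own. *)
Record adjoin1 (S : semigroupType) := Adjoin1 {
  adjoin1_val :> option S;
  adjoin1P : adjoin1_val || ~~ `[< has_identity S >]
}.

HB.instance Definition _ (S : semigroupType) := [isSub for @adjoin1_val S].
HB.instance Definition _ (S : semigroupType) := [Choice of adjoin1 S by <:].

Section Adjoin1.
Variable S : semigroupType.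
Implicit Types a b c : adjoin1 S.

Definition in_adjoin1 (s : S) : adjoin1 S := @Adjoin1 S (Some s) isT.

Definition adjoin1_mul_val (a b : option S) : option S :=
  match a, b with
  | Some s, Some t => Some (s * t)%g
  | Some s, None => Some s
  | None, _ => b
  end.

Fact adjoin1_mulP a b :
  adjoin1_mul_val a b || ~~ `[< has_identity S >].
Proof. by case: a b => [[a|] pa] [[b|] pb]. Qed.

Definition adjoin1_mul a b : adjoin1 S := Adjoin1 (adjoin1_mulP a b).

Fact adjoin1_mulA : associative adjoin1_mul.
Proof.
move=> [[a|] pa] [[b|] pb] [[c|] pc]; apply/val_inj => //=.
by rewrite mulgA.
Qed.

HB.instance Definition _ := isSemigroup.Build (adjoin1 S) adjoin1_mulA.

Lemma in_adjoin1M s t : in_adjoin1 (s * t)%g = (in_adjoin1 s * in_adjoin1 t)%g.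
Proof. exact/val_inj. Qed.

Lemma adjoin1_has_identity : has_identity (adjoin1 S).
Proof.
have [[e [e1 e2]]|nS] := pselect (has_identity S).
  have nid : ~~ ~~ `[< has_identity S >].
    by rewrite negbK; apply/asboolP; exists e.
  exists (in_adjoin1 e); split=> -[[s|] ps]; apply/val_inj => /=;
    by rewrite ?e1 ?e2 // (negbTE nid) in ps *.
have p1 : (None : option S) || ~~ `[< has_identity S >] by apply/asboolPn.
by exists (Adjoin1 p1); split=> -[[s|] ps]; apply/val_inj.
Qed.

Lemma in_adjoin1_surj : has_identity S -> forall a, exists s, a = in_adjoin1 s.
Proof.
move=> idS [[s|] ps]; first by exists s; apply/val_inj.
by have := ps; rewrite (introT (asboolP _) idS).
Qed.

End Adjoin1.

Section Cogrowth.
Variables (R : realType) (S : semigroupType) (X : finType).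
Variable f : {multiplicative word X -> S}.

Definition cogrowth_pairs (n : nat) : set (word X * word X) :=
  [set p : word X * word X | (size p.1 + size p.2 = n)%N /\ f p.1 = f p.2].

Lemma finite_cogrowth_pairs n : finite_set (cogrowth_pairs n).
Proof.
pose W := [set w : word X | (size w <= n)%N].
have finW : finite_set W.
  apply: (@sub_finite_set _ _
      (@letters X @^-1` range (fun w : n.-bseq X => w : seq X))).
    by move=> w Ww; exists (Bseq Ww).
  apply: finite_preimage; last exact/finite_image/finite_finset.
  by move=> u v _ _ /val_inj.
apply: sub_finite_set (finite_setX finW finW) => -[u v] [/= uv _].
by split; rewrite /W /= -uv ?leq_addr ?leq_addl.
Qed.

(* [fset_set] is the finite set itself, by [finite_cogrowth_pairs]. *)
Definition global_cogrowth (n : nat) : nat := #|` fset_set (cogrowth_pairs n)|.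

Definition global_cogrowth_rate : \bar R :=
  limn_esup (fun n => (((global_cogrowth n)%:R : R) `^ (n%:R^-1))%:E).

Definition maximal_global_cogrowth : Prop :=
  global_cogrowth_rate = (#|X|%:R)%:E.

End Cogrowth.

Section L2.
Variables (R : realType) (I : choiceType).
Local Notation C := (R[i]).
Implicit Types (v w : I -> C) (A B : (I -> C) -> (I -> C)).

Definition sqnorm2 v : \bar R := (\esum_(s in [set: I]) (ComplexField.Normc.normc (v s) ^+ 2)%:E)%E.

Definition l2 : set (I -> C) := [set v | (sqnorm2 v < +oo)%E].

Definition norm2 v : R := Num.sqrt (fine (sqnorm2 v)).

(* Operators on [l2] are represented by functions on all families [I -> C],
   of which only the values on [l2] are relevant. *)
Record bounded_operator A : Prop := BoundedOperator {
  operator_l2 : forall v, l2 v -> l2 (A v);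
  operator_linear : forall (a : C) v w, l2 v -> l2 w ->
    A (fun s => a * v s + w s) = (fun s => a * A v s + A w s);
  operator_bounded : exists k : R, forall v, l2 v -> norm2 (A v) <= k * norm2 v
}.

Definition invertible_on_l2 A : Prop :=
  exists2 B, bounded_operator B &
    forall v, l2 v -> A (B v) = v /\ B (A v) = v.

Definition l2_spectrum A : set C :=
  [set z | ~ invertible_on_l2 (fun v s => A v s - z * v s)].

Definition spectral_radius A : \bar R :=
  ereal_sup [set (ComplexField.Normc.normc z)%:E | z in l2_spectrum A].

(* Families indexed by [I] are summed along the net of finite subsets of [I];
   [sum] is the limit of that net. *)
Definition vecmx_terms (M : I -> I -> R) v (t : I) : I -> C^o :=
  fun s => v s * (M s t)%:C.

Definition vecmx (M : I -> I -> R) v : I -> C :=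
  fun t => sum (vecmx_terms M v t).

Definition defined_on_l2 (M : I -> I -> R) : Prop :=
  forall v, l2 v ->
    (forall t, cvg (partial_sum (vecmx_terms M v t) @ totally)) /\
    l2 (vecmx M v).

End L2.

Section RandomWalk.
Variables (R : realType) (S : semigroupType) (X : finType).
Variable f : {multiplicative word X -> S}.

Definition right_walk (s t : adjoin1 S) : R :=
  #|[pred x : X | (s * in_adjoin1 (f (letter x)))%g == t]|%:R / #|X|%:R.

Definition left_walk (s t : adjoin1 S) : R :=
  #|[pred x : X | (in_adjoin1 (f (letter x)) * s)%g == t]|%:R / #|X|%:R.

End RandomWalk.

(* Main.v *)
Require Import Defs.
From HB Require Import structures.
From mathcomp Require Import all_boot all_order all_algebra finmap.
From mathcomp Require Import all_classical all_reals all_analysis.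
From mathcomp Require Import showcase.summability.
From mathcomp Require Import complex zify ring lra.

(** The number 1 itself lies in the spectrum of both walk operators.

    Let [p n] be the law of the endpoint of a uniformly random word of length
    [n + 1].  Appending (for the right walk) or prepending (for the left walk)
    a uniform letter shows that [p n.+1 = p n M].  The number of pairs of words
    of lengths [i + 1], [j + 1] with equal values is [|X| ^ (i + j + 2)] times
    the inner product of [p i] and [p j], so maximal cogrowth prevents the
    norms of the [p n] from decaying exponentially.

    Suppose that [M - 1] had a bounded inverse [B], of norm [k].  Applying
    [M - 1] to [g = \sum_(j <= i < n) p i] telescopes to [p n - p j], hence
    [g = B (p n - p j)].  As all the [p i] are nonnegative, the squared norm of
    [g] dominates the sum of the squared norms [a i] of the [p i], and that of
    [p n - p j] is at most [a n + a j].  Therefore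
      [\sum_(j <= i < n) a i <= k ^ 2 * (a j + a n)],
    and [a i <= 1] because [p i] is a probability law.  With [j = 0] this makes
    [a] summable, so [a n] tends to 0 and each tail sum starting at [j] is at
    most [k ^ 2 * a j], that is, [k ^ 2] times the difference of two successive
    tails: the tails, and with them [a], decay geometrically
    ([tail_bound_geometric], [energy_geometric_of_invertible]).  By
    Cauchy-Schwarz ([esum_mul_le]) the cogrowth function is then at most
    [n * D * (rho * |X|) ^ n] with [rho < 1], whose exponential rate is smaller
    than [|X|]: a contradiction ([one_in_l2_spectrum]).

    Positivity makes the argument elementary: it replaces Gelfand's formula and
    the analyticity of the resolvent by a single inverse at the point 1. *)

Set Implicit Arguments.
Unset Strict Implicit.
Unset Printing Implicit Defensive.
Import Order.TTheory GRing.Theory Num.Theory.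
Import numFieldNormedType.Exports.
Local Open Scope classical_set_scope.
Local Open Scope ring_scope.
Local Open Scope complex_scope.

(** * Sequences: geometric decay and exponential rates *)

(** Letting [n] go to infinity, the tail [T j] of the series satisfies
    [T j <= K * a j = K * (T j - T j.+1)], hence
    [T j.+1 <= (1 - K^-1) * T j] once [K] is taken positive.
    The bound is written with a square so that [rho ^+ n] bounds a norm when [a]
    is a sequence of squared norms. *)
Lemma tail_bound_geometric (R : realType) (a : nat -> R) (K : R) :
  (forall n, 0 <= a n <= 1) ->
  (forall j n, (j <= n)%N -> \sum_(j <= k < n) a k <= K * (a j + a n)) ->
  exists C rho : R, [/\ 0 <= C, 0 < rho < 1 & forall n, a n <= C * (rho ^+ n) ^+ 2].
Proof.
move=> a01 aK.
(* c >= 2 keeps the ratio 1 - c^-1 strictly between 0 and 1 *)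
pose c := Num.max K 2.
have c2 : 2 <= c by rewrite le_max lexx orbT.
have c0 : 0 < c by apply: lt_le_trans c2.
have Kc : K <= c by rewrite le_max lexx.
have a0 n : 0 <= a n by case/andP: (a01 n).
have ac j n : (j <= n)%N -> \sum_(j <= k < n) a k <= c * (a j + a n).
  by move=> jn; apply: le_trans (aK _ _ jn) _; rewrite ler_wpM2r// addr_ge0.
have nd : {homo series a : m n / (m <= n)%N >-> m <= n}.
  by apply: nondecreasing_series.
have cvS : cvgn (series a).
  apply: nondecreasing_is_cvgn => //; exists (c * (1 + 1)) => _ [n _ <-].
  apply: le_trans (ac _ _ (leq0n n)) _; rewrite ler_wpM2l ?(ltW c0)// lerD//.
    by case/andP: (a01 0%N).
  by case/andP: (a01 n).
have acv := cvg_series_cvg_0 cvS.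
pose L := limn (series a).
pose T j := L - series a j.
have Tle j : T j <= c * a j.
  have h1 : series a n - series a j @[n --> \oo] --> T j.
    by apply: cvgB => //; exact: cvg_cst.
  have h2 : c * (a j + a n) @[n --> \oo] --> c * (a j + 0).
    by apply: cvgMr; apply: cvgD => //; exact: cvg_cst.
  rewrite -[a j]addr0 -(cvg_lim _ h1)// -(cvg_lim _ h2)//.
  apply: ler_lim; [exact: cvgP h1|exact: cvgP h2|].
  by near=> n; rewrite sub_series_geq ?ac//; near: n; exact: nbhs_infty_ge.
have T0 j : 0 <= T j by rewrite subr_ge0; exact: nondecreasing_cvgn_le.
have TS j : a j = T j - T j.+1 by rewrite /T /series /= big_nat_recr//=; ring.
pose r := 1 - c^-1.
have cV : 0 < c^-1 <= 2^-1 by rewrite invr_gt0 c0 lef_pV2 ?posrE.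
have r0 : 0 < r by rewrite /r; lra.
have r1 : r < 1 by rewrite /r; lra.
have Tr j : T j <= L * r ^+ j.
  elim: j => [|j IH]; first by rewrite /T /series /= big_geq// subr0 expr0 mulr1.
  rewrite exprS mulrCA.
  apply: (@le_trans _ _ (r * T j)); last by rewrite ler_wpM2l// ltW.
  have : c^-1 * T j <= T j - T j.+1 by rewrite -TS ler_pdivrMl.
  by rewrite /r mulrBl mul1r; lra.
exists L, (Num.sqrt r); split.
- by have := T0 0%N; rewrite /T /series /= big_geq// subr0.
- by rewrite sqrtr_gt0 r0 -[ltRHS]sqrtr1 ltr_sqrt.
- move=> n; rewrite exprAC sqr_sqrtr ?(ltW r0)//; apply: le_trans (Tr n).
  by rewrite TS lerBlDr lerDl.
Unshelve. all: by end_near.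
Qed.

(** Two rates strictly between [rho] and 1 are used: passing from [rho] to the
    first absorbs the factor [n], by Bernoulli's inequality; passing from the
    first to the second absorbs the constant. *)
Lemma linear_geometric_le (R : realType) (C rho : R) : 0 <= C -> 0 < rho < 1 ->
  exists2 s : R, 0 < s < 1 &
    \forall n \near \oo, n%:R * (C * rho ^+ n) <= s ^+ n.
Proof.
move=> C0 /andP[r0 r1].
pose s := (1 + rho) / 2; pose s' := (1 + s) / 2.
have s01 : rho < s < 1 by rewrite /s; lra.
have s's : s < s' < 1 by rewrite /s'; lra.
have s0 : 0 < s by lra.
have s'0 : 0 < s' by lra.
pose h := s / rho - 1.
have h0 : 0 < h by rewrite subr_gt0 ltr_pdivlMr// mul1r; lra.
exists s'; first by lra.
have cv : C / h * (s / s') ^+ n @[n --> \oo] --> (C / h * 0 : R).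
  have ss'0 : 0 <= s / s' := divr_ge0 (ltW s0) (ltW s'0).
  apply: cvgMr; apply: cvg_expr; rewrite (ger0_norm ss'0).
  by rewrite ltr_pdivrMr// mul1r; lra.
rewrite mulr0 in cv.
have : \forall n \near \oo, C / h * (s / s') ^+ n < 1 by exact: (cvgr_lt _ cv).
apply: filterS => n; rewrite expr_div_n [ltLHS]mulrA ltr_pdivrMr ?exprn_gt0//.
rewrite mul1r => /ltW; apply: le_trans.
(* Bernoulli's inequality for s / rho = 1 + h *)
have nh : n%:R * h <= (s / rho) ^+ n.
  have -> : s / rho = 1 + h by rewrite /h; ring.
  elim: n => [|n IH]; first by rewrite mul0r expr0.
  rewrite exprS mulrDl mul1r -natr1 mulrDl mul1r lerD//.
  by rewrite ler_peMr ?(ltW h0)// exprn_ege1// lerDl ltW.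
have : n%:R <= (s / rho) ^+ n / h by rewrite ler_pdivlMr.
move=> /(ler_wpM2r (mulr_ge0 C0 (exprn_ge0 n (ltW r0)))) /le_trans; apply.
rewrite expr_div_n le_eqVlt; apply/orP; left; apply/eqP; field.
by rewrite gt_eqF// expf_neq0// gt_eqF.
Qed.

Lemma limn_esup_le (R : realType) (u : (\bar R)^nat) (c : \bar R) :
  (\forall n \near \oo, (u n <= c)%E) -> (limn_esup u <= c)%E.
Proof.
move=> uc; apply: (@le_trans _ _ (ereal_sup (u @` [set n | (u n <= c)%E]))).
  by apply: ereal_inf_lbound; exists [set n | (u n <= c)%E].
by apply: ge_ereal_sup => _ [n ? <-].
Qed.

Lemma root_rate_le (R : realType) (g : nat -> nat) (d s : R) :
  0 <= d -> 0 <= s ->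
  (\forall n \near \oo, (g n)%:R <= d ^+ n * s ^+ n) ->
  (limn_esup (fun n => (((g n)%:R : R) `^ (n%:R^-1))%:E) <= (d * s)%:E)%E.
Proof.
move=> d0 s0 gs; apply: limn_esup_le.
near=> n; rewrite lee_fin; have n0 : (0 < n)%N by near: n; exact: nbhs_infty_gt.
have -> : d * s = ((d * s) ^+ n) `^ n%:R^-1.
  rewrite -powR_mulrn ?mulr_ge0// -powRrM divff ?pnatr_eq0 ?lt0n_neq0//.
  by rewrite powRr1 ?mulr_ge0.
apply: ge0_ler_powR; rewrite ?invr_ge0 ?nnegrE ?exprn_ge0 ?mulr_ge0//.
by rewrite exprMn; near: n.
Unshelve. all: by end_near.
Qed.

(** * Real vectors in l2 and transition matrices *)

#[local] Existing Instance totally_filter.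

Definition real_vec (R : realType) (I : choiceType) (x : I -> R) : I -> R[i] :=
  fun s => (x s)%:C.

(** The squared l2 norm, kept in the extended reals so that sums can be
    exchanged and compared before finiteness is known. *)
Definition energy (R : realType) (I : choiceType) (x : I -> R) : \bar R :=
  \esum_(s in [set: I]) (x s ^+ 2)%:E.

(** [x M = y] where each column sum becomes constant along the net of finite
    sets, as it does when [x] has finite support.  Unlike [vecmx M x = y], this
    is stable under linear combinations for an arbitrary matrix [M]. *)
Definition eventually_maps (R : realType) (I : choiceType) (M : I -> I -> R)
    (x y : I -> R) : Prop :=
  forall t, \forall A \near totally, partial_sum (fun s => x s * M s t) A = y t.

Lemma sqnorm2_real_vec (R : realType) (I : choiceType) (x : I -> R) :
  sqnorm2 (real_vec x) = energy x.
Proof.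
apply: eq_esum => s _; rewrite /ComplexField.Normc.normc /real_vec /=.
by rewrite expr0n addr0 sqrtr_sqr real_normK ?num_real.
Qed.

Lemma vecmx_real_vec (R : realType) (I : choiceType) (M : I -> I -> R) x y :
  eventually_maps M x y -> vecmx M (real_vec x) = real_vec y.
Proof.
move=> xy; apply/funext => t; rewrite /vecmx /sum.
apply: (@cvg_lim R[i]^o); first exact: norm_hausdorff.
apply: cvg_near_cst; apply: filterS (xy t) => A xyA.
rewrite /real_vec -xyA /partial_sum /vecmx_terms raddf_sum /=.
by apply: eq_bigr => i _; rewrite rmorphM.
Qed.

Lemma eventually_maps_delta (R : realType) (I : choiceType) (M : I -> I -> R) s :
  eventually_maps M (fun s' => (s == s')%:R) (M s).
Proof.
move=> t; exists [fset s]%fset => // A /=; rewrite fsub1set => sA.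
rewrite /partial_sum (bigD1 [` sA]%fset)//= eqxx mul1r big1 ?addr0// => i.
by rewrite -val_eqE /= eq_sym => /negbTE ->; rewrite mul0r.
Qed.

Lemma eventually_maps_scale (R : realType) (I : choiceType) (M : I -> I -> R) c x y :
  eventually_maps M x y ->
  eventually_maps M (fun s => c * x s) (fun t => c * y t).
Proof.
move=> xy t; apply: filterS (xy t) => A <-.
by rewrite /partial_sum mulr_sumr; apply: eq_bigr => i _; rewrite mulrA.
Qed.

Lemma eventually_maps_sum (R : realType) (I : choiceType) (M : I -> I -> R)
    (J : Type) (r : seq J) (x y : J -> I -> R) :
  (forall j, eventually_maps M (x j) (y j)) ->
  eventually_maps M (fun s => \sum_(j <- r) x j s) (fun t => \sum_(j <- r) y j t).
Proof.
move=> xy t; elim: r => [|j r IH].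
  apply: nearW => A; rewrite big_nil /partial_sum big1// => i _.
  by rewrite big_nil mul0r.
apply: filterS2 (xy j t) IH => A; rewrite big_cons => <- <-.
rewrite /partial_sum -big_split /=; apply: eq_bigr => i _.
by rewrite big_cons mulrDl.
Qed.

Lemma energy_ge0 (R : realType) (I : choiceType) (x : I -> R) : (0 <= energy x)%E.
Proof. by apply: esum_ge0 => s _; rewrite lee_fin sqr_ge0. Qed.

(** Nonnegativity removes the factor 2 of the general parallelogram bound:
    the cross term of the square has the favourable sign. *)
Lemma energyB_le (R : realType) (I : choiceType) (x y : I -> R) :
  (forall s, 0 <= x s) -> (forall s, 0 <= y s) ->
  (energy (fun s => x s - y s)%R <= energy x + energy y)%E.
Proof.
move=> x0 y0; rewrite /energy -esumD => [|s _|s _]; rewrite ?lee_fin ?sqr_ge0//.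
apply: le_esum => s _; rewrite -EFinD lee_fin.
by have := mulr_ge0 (x0 s) (y0 s); rewrite sqrrB; lra.
Qed.

Lemma energyD_fin (R : realType) (I : choiceType) (x y : I -> R) :
  (energy x < +oo)%E -> (energy y < +oo)%E -> (energy (fun s => x s + y s)%R < +oo)%E.
Proof.
move=> xoo yoo; apply: (@le_lt_trans _ _ ((energy x + energy y) + (energy x + energy y))%E).
  rewrite /energy -!esumD => [|s _|s _|s _|s _];
    rewrite -?EFinD ?lee_fin ?addr_ge0 ?sqr_ge0//.
  apply: le_esum => s _; rewrite -!EFinD lee_fin.
  by have := sqr_ge0 (x s - y s); rewrite sqrrB sqrrD; lra.
by rewrite !lte_add_pinfty.
Qed.

Lemma energy_sum_fin (R : realType) (I : choiceType) (J : Type) (r : seq J)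
    (x : J -> I -> R) :
  (forall j, (energy (x j) < +oo)%E) ->
  (energy (fun s => \sum_(j <- r) x j s)%R < +oo)%E.
Proof.
move=> xoo; elim: r => [|j r IH].
  rewrite /energy esum1 ?ltry// => s _; by rewrite big_nil expr0n.
have -> : (fun s => \sum_(k <- j :: r) x k s) = (fun s => x j s + \sum_(k <- r) x k s).
  by apply/funext => s; rewrite big_cons.
exact: energyD_fin.
Qed.

(** The cross terms in the square of a sum of nonnegative vectors are
    nonnegative. *)
Lemma sum_energy_le (R : realType) (I : choiceType) (J : choiceType) (r : seq J)
    (x : J -> I -> R) :
  (forall j s, 0 <= x j s) ->
  (\sum_(j <- r) energy (x j) <= energy (fun s => \sum_(j <- r) x j s)%R)%E.
Proof.
move=> x0; rewrite /energy -esum_sum => [|s j _ _]; last by rewrite lee_fin sqr_ge0.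
apply: le_esum => s _; rewrite sumEFin lee_fin.
elim: r => [|j r IH]; first by rewrite !big_nil expr0n.
rewrite !big_cons sqrrD.
have := mulr_ge0 (x0 j s) (sumr_ge0 _ (fun k _ => x0 k s) : 0 <= \sum_(k <- r) x k s).
lra.
Qed.

(** * Geometric decay from an inverse at 1 *)

(** The heart of the proof: the inverse of [M - 1], evaluated on the
    telescoping difference [p n - p j], controls the blocks
    [\sum_(j <= i < n) p i] by their two end terms. *)
Lemma energy_geometric_of_invertible (R : realType) (I : choiceType)
    (M : I -> I -> R) (p : nat -> I -> R) :
  (forall n s, 0 <= p n s) -> (forall n, (energy (p n) <= 1)%E) ->
  (forall n, eventually_maps M (p n) (p n.+1)) ->
  invertible_on_l2 (fun v s => vecmx M v s - 1 * v s) ->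
  exists C rho : R, [/\ 0 <= C, 0 < rho < 1 &
    forall n, (energy (p n) <= (C * (rho ^+ n) ^+ 2)%:E)%E].
Proof.
move=> p0 p1 pM [B [_ _ [k Bk]] MB].
have pfin n : energy (p n) \is a fin_num.
  by rewrite ge0_fin_numE ?energy_ge0// (le_lt_trans (p1 n)) ?ltry.
pose a n := fine (energy (p n)).
have aE n : energy (p n) = (a n)%:E by rewrite fineK.
have a01 n : 0 <= a n <= 1 by rewrite -!lee_fin -aE energy_ge0 p1.
have aK j n : (j <= n)%N -> \sum_(j <= i < n) a i <= k ^+ 2 * (a j + a n).
  move=> jn; pose g s : R := \sum_(j <= i < n) p i s.
  have gfin : (energy g < +oo)%E.
    by apply: energy_sum_fin => i; rewrite -ge0_fin_numE ?energy_ge0.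
  have gl2 : l2 (real_vec g) by rewrite /l2 /= sqnorm2_real_vec.
  have Mg : vecmx M (real_vec g) = real_vec (fun s => \sum_(j <= i < n) p i.+1 s).
    by apply: vecmx_real_vec; exact: eventually_maps_sum.
  pose d s := p n s - p j s.
  have Ag : (fun s => vecmx M (real_vec g) s - 1 * real_vec g s) = real_vec d.
    apply/funext => s; rewrite Mg mul1r /real_vec -raddfB /g -sumrB.
    by rewrite (telescope_sumr (fun i => p i s) jn).
  have dE : (energy d <= (a j + a n)%:E)%E.
    by rewrite addrC EFinD -!aE; exact: energyB_le.
  have dfin : (energy d < +oo)%E by rewrite (le_lt_trans dE) ?ltry.
  have dl2 : l2 (real_vec d) by rewrite /l2 /= sqnorm2_real_vec.
  have := Bk _ dl2; rewrite -Ag (MB _ gl2).2 Ag /norm2 !sqnorm2_real_vec => gd.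
  have sumg : \sum_(j <= i < n) a i <= fine (energy g).
    rewrite -lee_fin fineK ?ge0_fin_numE ?energy_ge0// -sumEFin.
    under eq_bigr do rewrite -aE.
    exact: sum_energy_le.
  apply: le_trans sumg _.
  have g0 : 0 <= fine (energy g) by rewrite fine_ge0 ?energy_ge0.
  have d0 : 0 <= fine (energy d) by rewrite fine_ge0 ?energy_ge0.
  have := lerXn2r 2 (sqrtr_ge0 _) (le_trans (sqrtr_ge0 _) gd) gd.
  rewrite exprMn !sqr_sqrtr// => /le_trans; apply; rewrite ler_wpM2l ?sqr_ge0//.
  by rewrite -lee_fin fineK// ge0_fin_numE ?energy_ge0.
have [C [rho [C0 rho01 aC]]] := tail_bound_geometric a01 aK.
by exists C, rho; split=> // n; rewrite aE lee_fin.
Qed.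

(** * Inner products and laws of uniform samples *)

Lemma esumZ_le (R : realType) (I : choiceType) (c : R) (a : I -> R) :
  0 <= c -> (forall s, 0 <= a s) ->
  (\esum_(s in [set: I]) (c * a s)%:E <= c%:E * \esum_(s in [set: I]) (a s)%:E)%E.
Proof.
move=> c0 a0; apply: ge_ereal_sup => _ [A Afin <-].
under eq_fsbigr do rewrite EFinM.
rewrite -ge0_mule_fsumr; last by move=> s; rewrite lee_fin.
by rewrite lee_wpmul2l ?lee_fin//; apply: ereal_sup_ubound; exists A.
Qed.

(** Cauchy-Schwarz, in the form of the weighted inequality
    [2 x y <= (b / a) x ^ 2 + (a / b) y ^ 2]. *)
Lemma esum_mul_le (R : realType) (I : choiceType) (x y : I -> R) (C a b : R) :
  0 < a -> 0 < b ->
  (energy x <= (C * a ^+ 2)%:E)%E -> (energy y <= (C * b ^+ 2)%:E)%E ->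
  (\esum_(s in [set: I]) (x s * y s)%:E <= (C * (a * b))%:E)%E.
Proof.
move=> a0 b0 xa yb.
have a2 : 0 <= b / a / 2 by rewrite !divr_ge0// ltW.
have b2 : 0 <= a / b / 2 by rewrite !divr_ge0// ltW.
apply: (@le_trans _ _ ((b / a / 2)%:E * energy x + (a / b / 2)%:E * energy y)%E).
  apply: le_trans (leeD (esumZ_le a2 (fun s => sqr_ge0 (x s)))
                        (esumZ_le b2 (fun s => sqr_ge0 (y s)))).
  rewrite -esumD => [|s _|s _]; rewrite ?lee_fin;
    rewrite ?(mulr_ge0 a2 (sqr_ge0 _)) ?(mulr_ge0 b2 (sqr_ge0 _))//.
  apply: le_esum => s _; rewrite -EFinD lee_fin -subr_ge0.
  have -> : b / a / 2 * x s ^+ 2 + a / b / 2 * y s ^+ 2 - x s * y s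
     = (b * x s - a * y s) ^+ 2 / (a * b * 2).
    by field; rewrite !gt_eqF.
  by rewrite divr_ge0 ?sqr_ge0// !mulr_ge0// ltW.
apply: (@le_trans _ _ ((b / a / 2)%:E * (C * a ^+ 2)%:E + (a / b / 2)%:E * (C * b ^+ 2)%:E)%E).
  by rewrite leeD// lee_wpmul2l ?lee_fin.
by rewrite -!EFinM -EFinD lee_fin le_eqVlt; apply/orP; left; apply/eqP; field; rewrite !gt_eqF.
Qed.

(** The law of [h j] for [j] uniform in [J]. *)
Definition law (R : realType) (I : choiceType) (J : finType) (h : J -> I) (t : I) : R :=
  #|J|%:R^-1 * \sum_(j : J) (h j == t)%:R.

Lemma law_ge0 (R : realType) (I : choiceType) (J : finType) (h : J -> I) t :
  0 <= law R h t.
Proof. by rewrite mulr_ge0 ?invr_ge0 ?ler0n// sumr_ge0. Qed.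

Lemma esum_delta (R : realType) (I : choiceType) (c : R) (s t : I) : 0 <= c ->
  \esum_(r in [set: I]) (c * ((s == r)%:R * (t == r)%:R))%:E = (c * (s == t)%:R)%:E.
Proof.
move=> c0; transitivity (\esum_(r in [set s]) (c * ((s == r)%:R * (t == r)%:R))%:E).
  rewrite [RHS]esum_mkcond; apply: eq_esum => r _.
  case: ifPn => // /negP rs; case: eqVneq => [sr|_]; last by rewrite mul0r mulr0.
  by case: rs; rewrite sr inE.
by rewrite esum_set1 ?lee_fin ?mulr_ge0// eqxx mul1r eq_sym.
Qed.

(** The inner product of two laws is the probability that independent samples
    coincide; this is what relates cogrowth to l2 norms. *)
Lemma esum_law_mul (R : realType) (I : choiceType) (J K : finType)
    (h : J -> I) (g : K -> I) :
  \esum_(t in [set: I]) (law R h t * law R g t)%:E =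
  ((#|J|%:R * #|K|%:R)^-1 * #|[pred jk : J * K | h jk.1 == g jk.2]|%:R)%:E :> \bar R.
Proof.
have c0 : 0 <= (#|J|%:R * #|K|%:R : R)^-1 by rewrite invr_ge0 mulr_ge0.
set c := _^-1 in c0 *.
transitivity (\esum_(t in [set: I]) \sum_(jk : J * K)
   (c * ((h jk.1 == t)%:R * (g jk.2 == t)%:R))%:E).
  apply: eq_esum => t _; rewrite sumEFin -mulr_sumr /law mulrACA -invfM; congr (c * _)%:E.
  by rewrite big_distrlr /= pair_bigA.
rewrite esum_sum => [|t jk _ _]; last by rewrite lee_fin !mulr_ge0.
under eq_bigr do rewrite esum_delta//.
rewrite sumEFin -mulr_sumr; congr (c * _)%:E.
by rewrite -sum1_card natr_sum [RHS]big_mkcond /=; apply: eq_bigr => jk _; rewrite inE; case: eqP.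
Qed.

Lemma energy_law_le1 (R : realType) (I : choiceType) (J : finType) (h : J -> I) :
  (energy (law R h) <= 1)%E.
Proof.
rewrite /energy; under eq_esum do rewrite expr2.
rewrite esum_law_mul lee_fin -natrM -card_prod.
have [->|J0] := posnP #|{: J * J}|; first by rewrite invr0 mul0r.
by rewrite ler_pdivrMl ?ltr0n// mulr1 ler_nat max_card.
Qed.

(** One step of the walk: the bijection [e] turns a pair of independent uniform
    samples, a starting point and a letter, into one uniform sample. *)
Lemma law_step (R : realType) (I : choiceType) (X J J' : finType)
    (act : I -> X -> I) (M : I -> I -> R) (h : J -> I) (h' : J' -> I) (e : J * X -> J') :
  (forall s t, M s t = #|[pred x | act s x == t]|%:R / #|X|%:R) ->
  bijective e -> (forall j x, h' (e (j, x)) = act (h j) x) ->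
  eventually_maps M (law R h) (law R h').
Proof.
move=> ME ebij he.
have := eventually_maps_scale #|J|%:R^-1 (eventually_maps_sum (index_enum J)
   (fun j => eventually_maps_delta M (h j))).
congr eventually_maps; apply/funext => t.
rewrite /law -(bij_eq_card ebij) card_prod natrM invfM -mulrA; congr (_ * _).
rewrite (reindex e) /=; last exact: onW_bij.
under eq_bigr do rewrite ME mulrC.
rewrite -mulr_sumr; congr (_ * _).
transitivity (\sum_j \sum_(x : X) (act (h j) x == t)%:R : R).
  apply: eq_bigr => j _; rewrite -sum1_card natr_sum big_mkcond /=.
  by apply: eq_bigr => x _; rewrite inE; case: eqP.
by rewrite pair_bigA /=; apply: eq_bigr => -[j x] _; rewrite he.
Qed.

(** * Random words and cogrowth *)

Lemma tuple_neq0 (X : finType) n (w : n.+1.-tuple X) : tval w != [::].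
Proof. by rewrite -size_eq0 size_tuple. Qed.

Definition tuple_word (X : finType) n (w : n.+1.-tuple X) : word X :=
  Word (tuple_neq0 w).

Definition endpoint (S : semigroupType) (X : finType) (f : {multiplicative word X -> S}) n
  (w : n.+1.-tuple X) : adjoin1 S := in_adjoin1 (f (tuple_word w)).

(** A uniform word followed by an independent uniform letter is a uniform word. *)
Lemma law_right_walk (R : realType) (S : semigroupType) (X : finType)
    (f : {multiplicative word X -> S}) n :
  eventually_maps (right_walk R f) (law R (endpoint f (n:=n))) (law R (endpoint f (n:=n.+1))).
Proof.
pose e (wx : n.+1.-tuple X * X) : n.+2.-tuple X := [tuple of rcons wx.1 wx.2].
apply: (@law_step _ _ _ _ _ (fun s x => s * in_adjoin1 (f (letter x)))%g _ _ _ e) => //.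
- exists (fun w => ([tuple of belast (thead w) (behead w)], last (thead w) (behead w))).
    move=> [w x]; congr pair; last first.
      by case: w => [[|y w] ?] //=; rewrite last_rcons.
    by apply/val_inj; case: w => [[|y w] ?] //=; rewrite belast_rcons.
  by move=> w; apply/val_inj; case/tupleP: w => y w /=; rewrite -lastI.
- move=> w x; rewrite /endpoint -in_adjoin1M -gmulfM; congr (in_adjoin1 (f _)).
  by apply/val_inj; rewrite /= cats1.
Qed.

(** As for the right walk, the new letter being put in front of the word. *)
Lemma law_left_walk (R : realType) (S : semigroupType) (X : finType)
    (f : {multiplicative word X -> S}) n :
  eventually_maps (left_walk R f) (law R (endpoint f (n:=n))) (law R (endpoint f (n:=n.+1))).
Proof.
pose e (wx : n.+1.-tuple X * X) : n.+2.-tuple X := [tuple of wx.2 :: wx.1].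
apply: (@law_step _ _ _ _ _ (fun s x => in_adjoin1 (f (letter x)) * s)%g _ _ _ e) => //.
- exists (fun w : n.+2.-tuple X => ([tuple of behead w], thead w)).
    by move=> [w x]; congr pair; exact/val_inj.
  by move=> w; rewrite [RHS]tuple_eta; exact/val_inj.
- move=> w x; rewrite /endpoint -in_adjoin1M -gmulfM; congr (in_adjoin1 (f _)).
  exact/val_inj.
Qed.

Definition coincidences (S : semigroupType) (X : finType)
    (f : {multiplicative word X -> S}) i j :=
  [pred uv : i.+1.-tuple X * j.+1.-tuple X |
    endpoint f uv.1 == endpoint f uv.2].

(** Pairs are sorted by the length [i + 1] of the first word; the second one
    then has length [n - (i + 1) = (n - 2 - i) + 1]. *)
Lemma global_cogrowth_le (S : semigroupType) (X : finType)
    (f : {multiplicative word X -> S}) n :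
  (global_cogrowth f n <=
    \sum_(0 <= i < n.-1) #|coincidences f i (n.-2 - i)|)%N.
Proof.
pose pairs i := [seq (tuple_word uv.1, tuple_word uv.2) |
                  uv <- enum (coincidences f i (n.-2 - i))].
have -> : (\sum_(0 <= i < n.-1) #|coincidences f i (n.-2 - i)|)%N =
    size (flatten [seq pairs i | i <- iota 0 n.-1]).
  rewrite size_flatten /shape -map_comp sumnE big_map /index_iota subn0.
  by apply: eq_bigr => i _; rewrite /= size_map -cardE.
apply: uniq_leq_size; first exact: fset_uniq.
move=> [u v]; rewrite in_fset_set; last exact: finite_cogrowth_pairs.
rewrite inE => -[/= uvn fuv].
have su : (0 < size u)%N by rewrite lt0n size_eq0 letters_neq0.
have sv : (0 < size v)%N by rewrite lt0n size_eq0 letters_neq0.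
have eu : size u == (size u).-1.+1 by rewrite prednK.
have ev : size v == (n.-2 - (size u).-1).+1 by apply/eqP; lia.
apply/flattenP; exists (pairs (size u).-1).
  by apply: map_f; rewrite mem_iota; lia.
have ue : tuple_word (Tuple eu) = u by exact/val_inj.
have ve : tuple_word (Tuple ev) = v by exact/val_inj.
apply/mapP; exists (Tuple eu, Tuple ev); last by rewrite /= ue ve.
by rewrite mem_enum inE /= /endpoint ue ve fuv.
Qed.

(** Left and right walks enter only through the fact that [M] carries the law of
    random words of each length to that of the next length. *)
Lemma one_in_l2_spectrum (R : realType) (S : semigroupType) (X : finType)
    (f : {multiplicative word X -> S}) (M : adjoin1 S -> adjoin1 S -> R) :
  (0 < #|X|)%N -> maximal_global_cogrowth R f ->
  (forall n, eventually_maps M (law R (endpoint f (n:=n))) (law R (endpoint f (n:=n.+1)))) ->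
  l2_spectrum (vecmx M) 1.
Proof.
move=> X0 fmax Mstep Minv.
have [C [rho [C0 /andP[r0 r1] decay]]] := energy_geometric_of_invertible
  (fun n => law_ge0 R (endpoint f (n:=n))) (fun n => energy_law_le1 R (endpoint f (n:=n)))
  Mstep Minv.
have X0R : 0 < #|X|%:R :> R by rewrite ltr0n.
have coinc i j : #|coincidences f i j|%:R <= #|X|%:R ^+ (i + j).+2 * (C * rho ^+ (i + j)) :> R.
  have := esum_mul_le (exprn_gt0 i r0) (exprn_gt0 j r0) (decay i) (decay j).
  rewrite esum_law_mul lee_fin !card_tuple !natrX -!exprD addnS addSn.
  by rewrite ler_pdivrMl ?exprn_gt0.
(* i + j = n - 2 when the words have total length n *)
pose D := C / rho ^+ 2.
have D0 : 0 <= D by rewrite divr_ge0// exprn_ge0// ltW.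
have gle n : (global_cogrowth f n)%:R <= n%:R * (D * rho ^+ n) * #|X|%:R ^+ n :> R.
  have := global_cogrowth_le f n; rewrite -(ler_nat R) => /le_trans; apply.
  rewrite natr_sum.
  apply: (@le_trans _ _ (\sum_(0 <= i < n.-1) D * rho ^+ n * #|X|%:R ^+ n)).
    rewrite ler_sum_nat// => i /andP[_ iln].
    apply: le_trans (coinc _ _) _; rewrite subnKC; last by lia.
    have -> : n.-2.+2 = n by lia.
    rewrite mulrC ler_wpM2r ?exprn_ge0// /D.
    have -> : rho ^+ n = rho ^+ n.-2 * rho ^+ 2 by rewrite -exprD; congr (_ ^+ _); lia.
    rewrite le_eqVlt; apply/orP; left; apply/eqP; field.
    by rewrite gt_eqF.
  rewrite sumr_const_nat subn0 -[leLHS]mulr_natl -[leRHS]mulrA ler_wpM2r ?ler_nat ?leq_pred//.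
  by rewrite mulr_ge0 ?exprn_ge0// (mulr_ge0 D0)// exprn_ge0// ltW.
have [s /andP[s0 s1] sle] := linear_geometric_le D0 (introT andP (conj r0 r1)).
have gs : \forall n \near \oo, (global_cogrowth f n)%:R <= #|X|%:R ^+ n * s ^+ n.
  apply: filterS sle => n sn; apply: le_trans (gle n) _.
  by rewrite mulrC ler_wpM2l// exprn_ge0// ltW.
have := root_rate_le (ltW X0R) (ltW s0) gs.
by rewrite -/(global_cogrowth_rate R f) fmax lee_fin leNgt gtr_pMr// s1.
Qed.

(** * The theorem *)

Lemma spectral_radius_ge1 (R : realType) (I : choiceType) (A : (I -> R[i]) -> I -> R[i]) :
  l2_spectrum A 1 -> (1 <= spectral_radius A)%E.
Proof.
move=> A1; apply: ereal_sup_ubound; exists 1 => //=.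
by rewrite /ComplexField.Normc.normc /= expr0n addr0 expr1n sqrtr1.
Qed.

Local Open Scope ereal_scope.

Theorem theorem5p11 (R : realType) (S : semigroupType) (X : finType)
    (f : {multiplicative word X -> S})
    (S_nonempty : inhabited S)
    (f_surj : forall s : S, exists w : word X, f w = s)
    (max_cogrowth : maximal_global_cogrowth R f) :
  (~ defined_on_l2 (right_walk R f) \/
     1 <= spectral_radius (vecmx (right_walk R f))) /\
  (~ defined_on_l2 (left_walk R f) \/
     1 <= spectral_radius (vecmx (left_walk R f))).
Proof.
have X0 : (0 < #|X|)%N.
  have [s] := S_nonempty; have [w _] := f_surj s.
  by case: w => [[|x w] //= _]; apply/card_gt0P; exists x.
split; right; apply/spectral_radius_ge1/(one_in_l2_spectrum X0 max_cogrowth) => n.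
  exact: law_right_walk.
exact: law_left_walk.
Qed.
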